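(* Let $M$ and $L$ be two regular and distributive weakly dicomplemented lattices such that $M$ is a subalgebra of $L$. If $\theta\in\mathrm{Con}(M)$, then there exists $\beta\in\mathrm{Con}(L)$ such that $\theta=\beta_{\mid M}$. Moreover, if $L$ is a regular WDL, then $\mathrm{Con}(M)$ embeds in $\mathrm{Con}(L)$.
   Context: A weakly dicomplemented lattice (WDL) is an algebra $(L;\wedge,\vee,{}^{\Delta},{}^{\nabla},0,1)$ of type $(2,2,1,1,0,0)$ such that $(L;\wedge,\vee,0,1)$ is a bounded lattice and for all $x,y\in L$: $x^{\Delta\Delta}\le x$; $x\le y\Rightarrow y^{\Delta}\le x^{\Delta}$; $(x\wedge y)\vee(x\wedge y^{\Delta})=x$; $x^{\nabla\nabla}\ge x$; $x\le y\Rightarrow y^{\nabla}\le x^{\nabla}$; $(x\vee y)\wedge(x\vee y^{\nabla})=x$. It is distributive if its underlying lattice is. $\mathrm{Con}(L)$ is the lattice of congruences (equivalence relations compatible with $\wedge,\vee,{}^{\Delta},{}^{\nabla}$), ordered by inclusion; $\beta_{\mid M}=\beta\cap M^{2}$. An algebra is regular if any two of its congruences $\theta,\beta$ with $[a]_{\theta}=[a]_{\beta}$ for some element $a$ are equal, where $[a]_\theta$ is the $\theta$-class of $a$. *)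

(* Defs.v *)
From HB Require Import structures.
From mathcomp Require Import all_boot all_order.
From mathcomp Require Import boolp classical_sets.

Set Implicit Arguments.
Unset Strict Implicit.
Unset Printing Implicit Defensive.

Import Order.TTheory.
Local Open Scope order_scope.

(* wcompl is the operation Delta, dwcompl is the operation nabla. The bounds
   are allowed to coincide: the one-element algebra is included. *)
HB.mixin Record TBLattice_isWDL d (L : Type) of Order.TBLattice d L := {
  wcompl : L -> L;
  dwcompl : L -> L;
  wcompl2_le : forall x : L, wcompl (wcompl x) <= x;
  wcompl_anti : forall x y : L, x <= y -> wcompl y <= wcompl x;
  wcompl_split : forall x y : L, (x `&` y) `|` (x `&` wcompl y) = x;
  dwcompl2_ge : forall x : L, x <= dwcompl (dwcompl x);
  dwcompl_anti : forall x y : L, x <= y -> dwcompl y <= dwcompl x;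
  dwcompl_split : forall x y : L, (x `|` y) `&` (x `|` dwcompl y) = x
}.

#[short(type="wdlType")]
HB.structure Definition WDL d :=
  { L of Order.TBLattice d L & TBLattice_isWDL d L }.

Definition distributive d (L : wdlType d) : Prop :=
  left_distributive (@Order.meet d L) (@Order.join d L).

HB.mixin Record isSubWDL d (L : wdlType d) (S : pred L) d' U
    of SubType L S U & WDL d' U := {
  val_wcompl : {morph (val : U -> L) : x / wcompl x >-> wcompl x};
  val_dwcompl : {morph (val : U -> L) : x / dwcompl x >-> dwcompl x}
}.

(* A subalgebra of L with universe S is a WDL on a subtype of L defined by S
   whose inclusion val commutes with all the operations. *)
#[short(type="subWdlType")]
HB.structure Definition SubWDL d (L : wdlType d) (S : pred L) d' :=
  { U of @Order.TBSubLattice d L S d' U & WDL d' U & @isSubWDL d L S d' U }.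

Record con d (L : wdlType d) := Con {
  con_rel :> L -> L -> Prop;
  con_refl : forall x, con_rel x x;
  con_sym : forall x y, con_rel x y -> con_rel y x;
  con_trans : forall x y z, con_rel x y -> con_rel y z -> con_rel x z;
  con_meet : forall x x' y y',
    con_rel x x' -> con_rel y y' -> con_rel (x `&` y) (x' `&` y');
  con_join : forall x x' y y',
    con_rel x x' -> con_rel y y' -> con_rel (x `|` y) (x' `|` y');
  con_wcompl : forall x x', con_rel x x' -> con_rel (wcompl x) (wcompl x');
  con_dwcompl : forall x x', con_rel x x' -> con_rel (dwcompl x) (dwcompl x')
}.

Lemma con_ext d (L : wdlType d) (a b : con L) :
  (forall x y, a x y <-> b x y) -> a = b.
Proof.
case: a b => [r ? ? ? ? ? ? ?] [s ? ? ? ? ? ? ?] /= rs.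
have rsE : r = s by apply/funext => x; apply/funext => y; apply/propext.
by subst s; congr Con; apply: Prop_irrelevance.
Qed.

HB.instance Definition _ d (L : wdlType d) := gen_eqMixin (con L).
HB.instance Definition _ d (L : wdlType d) := gen_choiceMixin (con L).

Fact con_display : Order.disp_t. Proof. exact: Order.Disp tt tt. Qed.

Section ConLattice.
Context d (L : wdlType d).
Implicit Types a b c : con L.

Definition con_le a b : bool := `[< forall x y, a x y -> b x y >].

Fact con_le_refl : reflexive con_le.
Proof. by move=> a; apply/asboolP. Qed.

Fact con_le_anti : antisymmetric con_le.
Proof.
move=> a b /andP[/asboolP ab /asboolP ba].
by apply: con_ext => x y; split; [exact: ab | exact: ba].
Qed.

Fact con_le_trans : transitive con_le.
Proof.
move=> b a c /asboolP ab /asboolP bc; apply/asboolP => x y /ab; exact: bc.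
Qed.

HB.instance Definition _ := Order.Le_isPOrder.Build con_display (con L)
  con_le_refl con_le_anti con_le_trans.

Definition con_gen_rel (r : L -> L -> Prop) (x y : L) : Prop :=
  forall c, (forall u v, r u v -> c u v) -> c x y.

Definition con_gen (r : L -> L -> Prop) : con L.
Proof.
refine (@Con _ L (con_gen_rel r) _ _ _ _ _ _ _).
- by move=> x c _; exact: con_refl.
- by move=> x y xy c rc; apply: con_sym; exact: xy.
- by move=> x y z xy yz c rc; apply: con_trans (xy c rc) (yz c rc).
- by move=> x x' y y' xx' yy' c rc; apply: con_meet; [exact: xx'|exact: yy'].
- by move=> x x' y y' xx' yy' c rc; apply: con_join; [exact: xx'|exact: yy'].
- by move=> x x' xx' c rc; apply: con_wcompl; exact: xx'.
- by move=> x x' xx' c rc; apply: con_dwcompl; exact: xx'.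
Defined.

Definition con_inf a b : con L.
Proof.
refine (@Con _ L (fun x y => a x y /\ b x y) _ _ _ _ _ _ _).
- by move=> x; split; exact: con_refl.
- by move=> x y [? ?]; split; exact: con_sym.
- by move=> x y z [? ?] [? ?]; split; apply: con_trans; eassumption.
- by move=> x x' y y' [? ?] [? ?]; split; exact: con_meet.
- by move=> x x' y y' [? ?] [? ?]; split; exact: con_join.
- by move=> x x' [? ?]; split; exact: con_wcompl.
- by move=> x x' [? ?]; split; exact: con_dwcompl.
Defined.

Definition con_sup a b : con L := con_gen (fun x y => a x y \/ b x y).

Fact con_infP a b c : (a <= con_inf b c) = (a <= b) && (a <= c).
Proof.
apply/asboolP/andP => [abc|[/asboolP ab /asboolP ac] x y axy].
  by split; apply/asboolP => x y /abc[].
by split; [exact: ab | exact: ac].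
Qed.

Fact con_supP a b c : (con_sup a b <= c) = (a <= c) && (b <= c).
Proof.
apply/asboolP/andP => [abc|[/asboolP ac /asboolP bc] x y].
  by split; apply/asboolP => x y xy; apply: abc => e re; apply: re; tauto.
by apply=> u v [/ac|/bc].
Qed.

HB.instance Definition _ := Order.POrder_MeetJoin_isLattice.Build con_display
  (con L) con_infP con_supP.

End ConLattice.

Definition con_class d (L : wdlType d) (a : con L) (x : L) : set L :=
  [set y | a x y].

Definition regular d (L : wdlType d) : Prop :=
  forall a b : con L,
    (exists x : L, con_class a x = con_class b x) -> a = b.

Definition con_restr d (L : wdlType d) (S : pred L) d' (M : subWdlType S d')
  (b : con L) : con M.
Proof.
refine (@Con _ M (fun x y : M => b (val x) (val y)) _ _ _ _ _ _ _).
- by move=> x; exact: con_refl.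
- by move=> x y; exact: con_sym.
- by move=> x y z; exact: con_trans.
- by move=> x x' y y' *; rewrite !Order.valI_subproof; exact: con_meet.
- by move=> x x' y y' *; rewrite !Order.valU_subproof; exact: con_join.
- by move=> x x' *; rewrite !val_wcompl; exact: con_wcompl.
- by move=> x x' *; rewrite !val_dwcompl; exact: con_dwcompl.
Defined.

(* Main.v *)
Require Import Defs.
From HB Require Import structures.
From mathcomp Require Import all_boot all_order.
From mathcomp Require Import boolp classical_sets.

Set Implicit Arguments.
Unset Strict Implicit.
Unset Printing Implicit Defensive.

Import Order.TTheory.
Local Open Scope order_scope.

(** The two weak complements, written here D and N, come from Galois
connections: D x <= y iff D y <= x, and dually for N.  Hence
D (x /\ y) = D x \/ D y and N (x \/ y) = N x /\ N y, and N u is always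
disjoint from u.

These identities show that on a distributive algebra a congruence can be
manufactured from a normal filter, that is, a filter closed under
u |-> N (D u): declare x and y related when x /\ u = y /\ u for some u in the
filter.  If u witnesses that x and y are related, then N (D u) witnesses it
both for D x, D y and for N x, N y.  Letting u range over any base of
the filter gives the same relation; this is the construction [base_con].

The class of 1 modulo a congruence theta of M is a normal filter.  Viewed as
a subset of M, it yields a congruence with the same class of 1 as theta, hence
theta itself by regularity ([regular_conP]).  Viewed as a subset of L, it is a
base of a normal filter of L and yields a congruence of L ([con_ext_sub]).
Both congruences are defined by the same equations x /\ u = y /\ u with u in
M, so the second one restricts to the first, namely theta ([con_ext_subK]).

The extension theta |-> con_ext_sub theta is therefore injective.  It
preserves meets because, by distributivity, x /\ u = y /\ u and
x /\ v = y /\ v imply x /\ (u \/ v) = y /\ (u \/ v), where u \/ v is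
congruent to 1 modulo both congruences.  It preserves joins because the join
of the extensions restricts to a congruence of M above both given ones, so
every u identified with 1 by their join is also identified with 1 by the join
of the extensions. *)

(** * Arithmetic of the weak complements *)

Section WeakComplements.
Context d (L : wdlType d).
Implicit Types x y z : L.

Lemma wcompl_le_swap x y : (wcompl x <= y) = (wcompl y <= x).
Proof.
by apply/idP/idP => /wcompl_anti xy; apply: le_trans xy (wcompl2_le _).
Qed.

Lemma le_dwcompl_swap x y : (y <= dwcompl x) = (x <= dwcompl y).
Proof.
by apply/idP/idP => /dwcompl_anti xy; apply: le_trans (dwcompl2_ge _) xy.
Qed.

Lemma wcomplI x y : wcompl (x `&` y) = wcompl x `|` wcompl y.
Proof.
apply/le_anti/andP; split.
  by rewrite wcompl_le_swap lexI -!(wcompl_le_swap _ (_ `|` _)) leUl leUr.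
by rewrite leUx !wcompl_anti ?leIl ?leIr.
Qed.

Lemma dwcomplU x y : dwcompl (x `|` y) = dwcompl x `&` dwcompl y.
Proof.
apply/le_anti/andP; split.
  by rewrite lexI !dwcompl_anti ?leUl ?leUr.
by rewrite le_dwcompl_swap leUx !(le_dwcompl_swap (_ `&` _)) leIl leIr.
Qed.

Lemma wcompl1 : wcompl (\top : L) = \bot.
Proof. by apply/eqP; rewrite -lex0 wcompl_le_swap lex1. Qed.

Lemma dwcompl0 : dwcompl (\bot : L) = \top.
Proof. by apply/eqP; rewrite -le1x le_dwcompl_swap le0x. Qed.

Lemma meet_dwcompl x : x `&` dwcompl x = \bot.
Proof. by rewrite -[RHS](dwcompl_split \bot x) !join0x. Qed.

End WeakComplements.

(** * Congruences generated by normal filters *)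

(** The up-set of such a set is a normal filter.  Unlike filters, these sets
are sent to sets of the same kind by the inclusion of a subalgebra. *)
Record normal_base d (L : wdlType d) (B : set L) : Prop := NormalBase {
  nbase1 : B \top;
  nbaseI : forall u v, B u -> B v -> B (u `&` v);
  nbaseN : forall u, B u -> B (dwcompl (wcompl u))
}.

Section BaseCongruence.
Context d (L : wdlType d) (distrL : distributive L).
Implicit Types (x y u v : L) (B : set L).

Definition base_rel B x y : Prop := exists2 u, B u & x `&` u = y `&` u.

Lemma meet_eqIl x y u v : x `&` u = y `&` u ->
  x `&` (u `&` v) = y `&` (u `&` v).
Proof. by move=> xy; rewrite !meetA xy. Qed.

Lemma meet_eqIr x y u v : x `&` v = y `&` v ->
  x `&` (u `&` v) = y `&` (u `&` v).
Proof. by rewrite [u `&` v]meetC; exact: meet_eqIl. Qed.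

(** The image of the equation under wcompl is an equation between joins with
wcompl u; meeting with dwcompl (wcompl u), which is disjoint from wcompl u,
removes this term. *)
Lemma meet_eq_wcompl x y u : x `&` u = y `&` u ->
  wcompl x `&` dwcompl (wcompl u) = wcompl y `&` dwcompl (wcompl u).
Proof.
have E z : wcompl z `&` dwcompl (wcompl u)
    = wcompl (z `&` u) `&` dwcompl (wcompl u).
  by rewrite wcomplI distrL meet_dwcompl joinx0.
by move=> xy; rewrite (E x) (E y) xy.
Qed.

(** Splitting z along u gives dwcompl z as a meet of dwcompl (z `&` u) and
dwcompl (z `&` wcompl u), and the second factor lies above
dwcompl (wcompl u). *)
Lemma meet_eq_dwcompl x y u : x `&` u = y `&` u ->
  dwcompl x `&` dwcompl (wcompl u) = dwcompl y `&` dwcompl (wcompl u).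
Proof.
have E z : dwcompl z `&` dwcompl (wcompl u)
    = dwcompl (z `&` u) `&` dwcompl (wcompl u).
  rewrite -[in LHS](wcompl_split z u) dwcomplU -meetA; congr (_ `&` _).
  by apply/meet_idPr/dwcompl_anti/leIr.
by move=> xy; rewrite (E x) (E y) xy.
Qed.

Definition base_con B (nB : normal_base B) : con L.
Proof.
refine (@Con _ L (base_rel B) _ _ _ _ _ _ _).
- by move=> x; exists \top; [exact: nbase1|].
- by move=> x y [u Bu xy]; exists u.
- move=> x y z [u Bu xy] [v Bv yz]; exists (u `&` v); first exact: nbaseI.
  by rewrite (meet_eqIl _ xy) (meet_eqIr _ yz).
- move=> x x' y y' [u Bu xx'] [v Bv yy'].
  exists (u `&` v); first exact: nbaseI.
  by rewrite -2!meetA (meet_eqIr _ yy') meetCA (meet_eqIl _ xx') meetCA.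
- move=> x x' y y' [u Bu xx'] [v Bv yy'].
  exists (u `&` v); first exact: nbaseI.
  by rewrite 2!distrL (meet_eqIl _ xx') (meet_eqIr _ yy').
- move=> x x' [u Bu xx']; exists (dwcompl (wcompl u)); first exact: nbaseN.
  exact: meet_eq_wcompl.
- move=> x x' [u Bu xx']; exists (dwcompl (wcompl u)); first exact: nbaseN.
  exact: meet_eq_dwcompl.
Defined.

End BaseCongruence.

Section RegularCongruence.
Context d (L : wdlType d) (distrL : distributive L) (regL : regular L).
Implicit Types (theta : con L) (x y u : L).

Lemma con_class1_base theta : normal_base (con_class theta \top).
Proof.
split; first exact: con_refl.
  by move=> u v tu tv; rewrite /con_class /= -(meetxx \top); exact: con_meet.
move=> u tu; rewrite /con_class /= -dwcompl0 -wcompl1.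
exact/con_dwcompl/con_wcompl.
Qed.

Lemma con_class1_up theta u x : theta \top u -> u <= x -> theta \top x.
Proof.
move=> tu /join_idPl ux.
by have := con_join tu (con_refl theta x); rewrite join1x joinC ux.
Qed.

(** The congruence built from the class of 1 always has that same class of 1;
regularity then forces it to be the original congruence. *)
Lemma regular_conP theta x y :
  theta x y <-> base_rel (con_class theta \top) x y.
Proof.
suff E : base_con distrL (con_class1_base theta) = theta by rewrite -{1}E.
apply: regL; exists \top; apply/seteqP; split => z /=.
  move=> [u tu]; rewrite meet1x => uz.
  by apply: con_class1_up tu _; rewrite uz leIl.
by exists z; rewrite // meet1x meetxx.
Qed.

End RegularCongruence.

(** * Extending congruences from a subalgebra *)

Section Extension.
Context d d' (L : wdlType d) (S : pred L) (M : subWdlType S d').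
Hypotheses (distrM : distributive M) (distrL : distributive L).
Hypothesis (regM : regular M).
Implicit Types theta phi : con M.

Lemma image_normal_base (B : set M) :
  normal_base B -> normal_base (val @` B : set L).
Proof.
move=> nB; split.
- by exists \top; [exact: nbase1 | rewrite omorph1].
- move=> _ _ [u Bu <-] [v Bv <-]; exists (u `&` v); first exact: nbaseI.
  by rewrite Order.valI_subproof.
- move=> _ [u Bu <-]; exists (dwcompl (wcompl u)); first exact: nbaseN.
  by rewrite val_dwcompl val_wcompl.
Qed.

Definition con_ext_sub theta : con L :=
  base_con distrL (image_normal_base (con_class1_base theta)).

Lemma con_ext_subP theta (x y : L) :
  con_ext_sub theta x y <->
  exists2 u : M, theta \top u & x `&` val u = y `&` val u.
Proof.
split=> [[_ [u tu <-] xy]|[u tu xy]]; first by exists u.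
by exists (val u) => //; exists u.
Qed.

Lemma con_ext_subK theta : con_restr M (con_ext_sub theta) = theta.
Proof.
apply: con_ext => x y; rewrite (regular_conP distrM regM theta).
apply: (iff_trans (con_ext_subP theta _ _)).
split=> -[u tu]; rewrite -?Order.valI_subproof => xy; exists u => //.
  exact: val_inj.
by rewrite -!Order.valI_subproof xy.
Qed.

Lemma con_ext_sub_le theta phi :
  theta <= phi -> con_ext_sub theta <= con_ext_sub phi.
Proof.
move=> /asboolP tp; apply/asboolP => x y /con_ext_subP[u tu xy].
by apply/con_ext_subP; exists u; first exact: tp.
Qed.

Lemma con_ext_subI : {morph con_ext_sub : theta phi / theta `&` phi}.
Proof.
move=> theta phi; apply/le_anti/andP; split.
  by rewrite lexI !con_ext_sub_le ?leIl ?leIr.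
apply/asboolP => x y [/con_ext_subP[u tu xyu] /con_ext_subP[v pv xyv]].
apply/con_ext_subP; exists (u `|` v).
  by split; [apply: con_class1_up tu _ | apply: con_class1_up pv _];
    rewrite ?leUl ?leUr.
rewrite Order.valU_subproof ![_ `&` (_ `|` _)]meetC !distrL.
by rewrite ![val _ `&` _]meetC xyu xyv.
Qed.

Lemma con_ext_subU : {morph con_ext_sub : theta phi / theta `|` phi}.
Proof.
move=> theta phi; apply/le_anti/andP; split; last first.
  by rewrite leUx !con_ext_sub_le ?leUl ?leUr.
set b := con_ext_sub theta `|` con_ext_sub phi.
have le_restr psi : con_ext_sub psi <= b -> psi <= con_restr M b.
  move=> /asboolP pb; apply/asboolP => x y.
  by rewrite -{1}(con_ext_subK psi) => /pb.
have /asboolP tpb : theta `|` phi <= con_restr M b.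
  by rewrite leUx !le_restr ?leUl ?leUr.
apply/asboolP => x y /con_ext_subP[u /tpb /= + xy]; rewrite omorph1 => b1u.
(* modulo b one has x = x `&` 1, x `&` u = y `&` u, y `&` 1 = y *)
have meet_u z : b z (z `&` val u).
  by rewrite -[X in b X]meetx1; apply: con_meet => //; exact: con_refl.
by apply: con_trans (meet_u x) _; rewrite xy; apply: con_sym.
Qed.

End Extension.

Theorem theorem30 (d d' : Order.disp_t) (L : wdlType d) (S : pred L)
    (M : subWdlType S d')
    (distrM : distributive M) (distrL : distributive L)
    (regM : regular M) (regL : regular L) :
  (forall theta : con M, exists beta : con L, theta = con_restr M beta) /\
  (exists f : {lmorphism con M -> con L}, injective f).
Proof.
have extK := con_ext_subK distrM distrL regM.
split=> [theta|]; first by exists (con_ext_sub distrL theta).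
pose ext_le := Order.isOrderMorphism.Build _ _ _ _ (con_ext_sub distrL)
  (@con_ext_sub_le _ _ _ _ M distrL).
pose ext_meet := Order.isMeetLatticeMorphism.Build _ _ _ _ (con_ext_sub distrL)
  (@con_ext_subI _ _ _ _ M distrL).
pose ext_join := Order.isJoinLatticeMorphism.Build _ _ _ _ (con_ext_sub distrL)
  (con_ext_subU distrM distrL regM).
pose f : {lmorphism con M -> con L} :=
  HB.pack (con_ext_sub distrL) ext_le ext_meet ext_join.
by exists f; exact: can_inj extK.
Qed.
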